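(* Let $\tau=\sigma_1\sigma_2\sigma_3$ and $\Delta=\sigma_1\sigma_2\sigma_3\sigma_1\sigma_2\sigma_1$ in $B_4$, let $G=\langle\tau,\Delta\rangle$ be the subgroup of $B_4$ generated by $\tau$ and $\Delta$, and let $Z$ be the center of $B_4$. Then a presentation of the quotient group $G/Z$ is given by $$\langle\tau,\Delta\mid\tau^4=\Delta^2=1\rangle,$$ where the generators $\tau,\Delta$ of the presentation correspond to the classes of $\tau,\Delta$ in $G/Z$.
   Context: $B_4$ is the braid group on four strands with standard generators $\sigma_1,\sigma_2,\sigma_3$ and relations $\sigma_1\sigma_2\sigma_1=\sigma_2\sigma_1\sigma_2$, $\sigma_2\sigma_3\sigma_2=\sigma_3\sigma_2\sigma_3$, $\sigma_1\sigma_3=\sigma_3\sigma_1$. The center $Z$ of $B_4$ is infinite cyclic, generated by $\theta=\tau^4=\Delta^2$; in particular $Z\subset G$. *)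

(* Defs.v *)
From HB Require Import structures.
From mathcomp Require Import all_boot.
From mathcomp Require Import generic_quotient boolp classical_sets functions.

Set Implicit Arguments.
Unset Strict Implicit.
Unset Printing Implicit Defensive.

Local Open Scope classical_set_scope.
Local Open Scope group_scope.
Local Open Scope quotient_scope.

Definition is_subgroup (G : groupType) (H : set G) : Prop :=
  H 1 /\ forall x y, H x -> H y -> H (x / y).

Definition is_normal_subgroup (G : groupType) (N : set G) : Prop :=
  is_subgroup N /\ forall x y, N x -> N (x ^ y).

Definition generated_subgroup (G : groupType) (A : set G) : set G :=
  smallest (@is_subgroup G) A.

Definition normal_closure (G : groupType) (A : set G) : set G :=
  smallest (@is_normal_subgroup G) A.

Definition center (G : groupType) : set G :=
  [set z | forall x, commute z x].
Arguments center : clear implicits.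

Record normal_subgroup (G : groupType) := NormalSubgroup {
  normal_set :> set G;
  normal_setP : is_normal_subgroup normal_set }.

Lemma normal_closure_normal (G : groupType) (A : set G) :
  is_normal_subgroup (normal_closure A).
Proof.
split; first split.
- by move=> N [[[]]].
- by move=> x y Nx Ny N NA; apply: NA.1.1.2; [apply: Nx | apply: Ny].
- by move=> x y Nx N NA; apply: NA.1.2; apply: Nx.
Qed.

Definition normal_closure_group (G : groupType) (A : set G) :=
  NormalSubgroup (normal_closure_normal A).

Lemma center_normal (G : groupType) : is_normal_subgroup (center G).
Proof.
split; first split.
- by move=> x; apply: commute_sym; apply: commute1.
- move=> x y Zx Zy z; apply: commute_sym; apply: commuteM.
    by apply: commute_sym; apply: Zx.
  by apply: commuteV; apply: commute_sym; apply: Zy.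
- by move=> x y Zx; rewrite /conjg (Zx y) mulKg.
Qed.

Definition center_group (G : groupType) := NormalSubgroup (center_normal G).
Arguments center_group : clear implicits.

Section Quotient.
Context (G : groupType) (N : normal_subgroup G).

Definition coset_rel : rel G := fun x y => `[< normal_set N (x^-1 * y) >].

Let N1 : normal_set N 1. Proof. exact: (normal_setP N).1.1. Qed.
Let NF x y : normal_set N x -> normal_set N y -> normal_set N (x / y).
Proof. exact: (normal_setP N).1.2. Qed.
Let NV x : normal_set N x -> normal_set N x^-1.
Proof. by move=> /(NF N1); rewrite mul1g. Qed.
Let NM x y : normal_set N x -> normal_set N y -> normal_set N (x * y).
Proof. by move=> Nx /NV /(NF Nx); rewrite invgK. Qed.
Let NJ x y : normal_set N x -> normal_set N (x ^ y).
Proof. exact: (normal_setP N).2. Qed.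

Lemma coset_rel_refl : reflexive coset_rel.
Proof. by move=> x; apply/asboolP; rewrite mulVg; apply: N1. Qed.

Lemma coset_rel_sym : symmetric coset_rel.
Proof.
move=> x y; apply/idP/idP => /asboolP /NV xy; apply/asboolP;
by rewrite invgM invgK in xy.
Qed.

Lemma coset_rel_trans : transitive coset_rel.
Proof.
move=> y x z /asboolP xy /asboolP yz; apply/asboolP.
by have := NM xy yz; rewrite mulgA mulgK.
Qed.

Definition coset_equiv :=
  EquivRel coset_rel coset_rel_refl coset_rel_sym coset_rel_trans.

Definition quotient_group := {eq_quot coset_equiv}.

HB.instance Definition _ := Choice.on quotient_group.

Definition coset (x : G) : quotient_group := \pi_quotient_group x.

Lemma cosetP (x y : G) : coset x = coset y <-> normal_set N (x^-1 * y).
Proof.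
split; first by move/eqmodP => /asboolP.
by move=> Nxy; apply/eqmodP; apply/asboolP.
Qed.

Lemma coset_repr (X : quotient_group) : coset (repr X) = X.
Proof. exact: reprK. Qed.

Definition quotient_mul (X Y : quotient_group) := coset (repr X * repr Y).
Definition quotient_inv (X : quotient_group) := coset (repr X)^-1.

Lemma cosetM (x y : G) : quotient_mul (coset x) (coset y) = coset (x * y).
Proof.
apply/cosetP; set u := repr _; set v := repr _.
have /cosetP ux : coset u = coset x by exact: coset_repr.
have /cosetP vy : coset v = coset y by exact: coset_repr.
have := NM (NJ v ux) vy.
by rewrite /conjg invgM !mulgA mulgK.
Qed.

Lemma cosetV (x : G) : quotient_inv (coset x) = coset x^-1.
Proof.
apply/cosetP; set u := repr _.
have /cosetP ux : coset x = coset u by rewrite /u coset_repr.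
by have := NJ x^-1 ux; rewrite /conjg !invgK !mulgA mulgV mul1g.
Qed.

Lemma coset_ind (P : quotient_group -> Prop) :
  (forall x, P (coset x)) -> forall X, P X.
Proof. by move=> Px X; rewrite -(coset_repr X). Qed.

Lemma quotient_mulA : associative quotient_mul.
Proof.
elim/coset_ind=> x; elim/coset_ind=> y; elim/coset_ind=> z.
by rewrite !cosetM mulgA.
Qed.

Lemma quotient_mul1g : left_id (coset 1) quotient_mul.
Proof. by elim/coset_ind=> x; rewrite cosetM mul1g. Qed.

Lemma quotient_mulg1 : right_id (coset 1) quotient_mul.
Proof. by elim/coset_ind=> x; rewrite cosetM mulg1. Qed.

Lemma quotient_mulVg : left_inverse (coset 1) quotient_inv quotient_mul.
Proof. by elim/coset_ind=> x; rewrite cosetV cosetM mulVg. Qed.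

Lemma quotient_mulgV : right_inverse (coset 1) quotient_inv quotient_mul.
Proof. by elim/coset_ind=> x; rewrite cosetV cosetM mulgV. Qed.

HB.instance Definition _ := isGroup.Build quotient_group
  quotient_mulA quotient_mul1g quotient_mulg1 quotient_mulVg quotient_mulgV.

Lemma coset_morphism (x y : G) : coset (x * y) = coset x * coset y.
Proof. by rewrite -cosetM. Qed.

End Quotient.

Section FreeGroup.
Context (n : nat).

(* (i, false) is the i-th generator and (i, true) its formal inverse *)
Definition word := seq ('I_n * bool).

Inductive free_eq : word -> word -> Prop :=
| free_eq_refl u : free_eq u u
| free_eq_sym u v : free_eq u v -> free_eq v u
| free_eq_trans v u w : free_eq u v -> free_eq v w -> free_eq u w
| free_eq_cancel u v i b :
    free_eq (u ++ (i, b) :: (i, ~~ b) :: v) (u ++ v).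

Definition free_rel : rel word := fun u v => `[< free_eq u v >].

Lemma free_rel_refl : reflexive free_rel.
Proof. by move=> u; apply/asboolP; apply: free_eq_refl. Qed.

Lemma free_rel_sym : symmetric free_rel.
Proof.
by move=> u v; apply/idP/idP => /asboolP uv; apply/asboolP; apply: free_eq_sym.
Qed.

Lemma free_rel_trans : transitive free_rel.
Proof.
move=> v u w /asboolP uv /asboolP vw; apply/asboolP.
exact: (free_eq_trans uv).
Qed.

Definition free_equiv :=
  EquivRel free_rel free_rel_refl free_rel_sym free_rel_trans.

Definition free_group := {eq_quot free_equiv}.

HB.instance Definition _ := Choice.on free_group.

Definition word_class (u : word) : free_group := \pi_free_group u.

Definition inv_letter (a : 'I_n * bool) := (a.1, ~~ a.2).
Definition inv_word (u : word) : word := rev (map inv_letter u).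

Lemma word_classP (u v : word) : word_class u = word_class v <-> free_eq u v.
Proof.
split; first by move/eqmodP => /asboolP.
by move=> uv; apply/eqmodP; apply/asboolP.
Qed.

Lemma word_class_repr (x : free_group) : word_class (repr x) = x.
Proof. exact: reprK. Qed.

Lemma word_class_ind (P : free_group -> Prop) :
  (forall u, P (word_class u)) -> forall x, P x.
Proof. by move=> Pu x; rewrite -(word_class_repr x). Qed.

Lemma free_eq_cat u u' v v' :
  free_eq u u' -> free_eq v v' -> free_eq (u ++ v) (u' ++ v').
Proof.
move=> uu' vv'; apply: (@free_eq_trans (u' ++ v)).
  elim: uu' => {u u'} [u|u w _|w u x _ uw _|u w i b].
  - exact: free_eq_refl.
  - exact: free_eq_sym.
  - exact: free_eq_trans.
  - by rewrite -!catA; apply: free_eq_cancel.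
elim: vv' => {v v'} [v|v w _|w v x _ vw _|v w i b].
- exact: free_eq_refl.
- exact: free_eq_sym.
- exact: free_eq_trans.
- by rewrite !catA; apply: free_eq_cancel.
Qed.

Lemma free_eq_inv u v : free_eq u v -> free_eq (inv_word u) (inv_word v).
Proof.
elim=> {u v} [u|u v _|w u v _ uw _|u v i b].
- exact: free_eq_refl.
- exact: free_eq_sym.
- exact: free_eq_trans.
- rewrite /inv_word !map_cat !rev_cat /= !rev_cons -!cats1 -!catA /=.
  rewrite /inv_letter /= negbK.
  exact: free_eq_cancel.
Qed.

Lemma inv_letterK : involutive inv_letter.
Proof. by case=> i b; rewrite /inv_letter /= negbK. Qed.

Lemma inv_wordK : involutive inv_word.
Proof.
by move=> u; rewrite /inv_word map_rev revK -map_comp map_id_in // => a _;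
  rewrite /= inv_letterK.
Qed.

Lemma free_eq_mulV u : free_eq (u ++ inv_word u) [::].
Proof.
elim: u => [|[i b] u IH]; first exact: free_eq_refl.
rewrite /inv_word /= rev_cons -cats1 catA -/(inv_word u).
apply: free_eq_trans (free_eq_cancel [::] [::] i b).
apply: (@free_eq_cat [:: (i, b)] [:: (i, b)]); first exact: free_eq_refl.
by apply: (@free_eq_cat _ [::]) => //; apply: free_eq_refl.
Qed.

Definition free_mul (x y : free_group) := word_class (repr x ++ repr y).
Definition free_inv (x : free_group) := word_class (inv_word (repr x)).

Lemma word_classM u v : free_mul (word_class u) (word_class v) = word_class (u ++ v).
Proof.
by apply/word_classP; apply: free_eq_cat; apply/word_classP;
  rewrite word_class_repr.
Qed.

Lemma word_classV u : free_inv (word_class u) = word_class (inv_word u).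
Proof.
by apply/word_classP; apply: free_eq_inv; apply/word_classP;
  rewrite word_class_repr.
Qed.

Lemma free_mulA : associative free_mul.
Proof.
elim/word_class_ind=> u; elim/word_class_ind=> v; elim/word_class_ind=> w.
by rewrite !word_classM catA.
Qed.

Lemma free_mul1g : left_id (word_class [::]) free_mul.
Proof. by elim/word_class_ind=> u; rewrite word_classM. Qed.

Lemma free_mulg1 : right_id (word_class [::]) free_mul.
Proof. by elim/word_class_ind=> u; rewrite word_classM cats0. Qed.

Lemma free_mulgV : right_inverse (word_class [::]) free_inv free_mul.
Proof.
elim/word_class_ind=> u; rewrite word_classV word_classM.
by apply/word_classP; apply: free_eq_mulV.
Qed.

Lemma free_mulVg : left_inverse (word_class [::]) free_inv free_mul.
Proof.
elim/word_class_ind=> u; rewrite word_classV -{2}[u]inv_wordK word_classM.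
by apply/word_classP; apply: free_eq_mulV.
Qed.

HB.instance Definition _ := isGroup.Build free_group
  free_mulA free_mul1g free_mulg1 free_mulVg free_mulgV.

Definition free_gen (i : 'I_n) : free_group := word_class [:: (i, false)].

End FreeGroup.

(* The group presented by n generators and the set R of relators. *)
Definition presented_group (n : nat) (R : set (free_group n)) : groupType :=
  quotient_group (normal_closure_group R).

Definition presented_gen (n : nat) (R : set (free_group n)) (i : 'I_n) :
  presented_group R := coset (normal_closure_group R) (free_gen i).

(* A relation u = v is encoded by the relator u / v. *)
Definition braid4_relators : set (free_group 3) :=
  let s1 : free_group 3 := free_gen (inord 0) in
  let s2 : free_group 3 := free_gen (inord 1) in
  let s3 : free_group 3 := free_gen (inord 2) in
  [set (s1 * s2 * s1) / (s2 * s1 * s2);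
       (s2 * s3 * s2) / (s3 * s2 * s3);
       (s1 * s3) / (s3 * s1)].

Definition B4 : groupType := presented_group braid4_relators.

Definition sigma1 : B4 := presented_gen braid4_relators (inord 0).
Definition sigma2 : B4 := presented_gen braid4_relators (inord 1).
Definition sigma3 : B4 := presented_gen braid4_relators (inord 2).

Definition tau : B4 := sigma1 * sigma2 * sigma3.
Definition Delta : B4 := sigma1 * sigma2 * sigma3 * sigma1 * sigma2 * sigma1.

Definition G : set B4 := generated_subgroup [set tau; Delta].

Definition Z : normal_subgroup B4 := center_group B4.

(* G / Z, as the set of cosets g Z (g in G) inside the group B4 / Z. *)
Definition G_mod_Z : set (quotient_group Z) := coset Z @` G.

(* <tau, Delta | tau^4 = Delta^2 = 1>: generator 0 is tau, generator 1 is
   Delta. *)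
Definition tau_Delta_relators : set (free_group 2) :=
  [set free_gen (inord 0) ^+ 4; free_gen (inord 1) ^+ 2].

(* Main.v *)
Require Import Defs.
From HB Require Import structures.
From mathcomp Require Import all_boot zmodp.
From mathcomp Require Import boolp classical_sets functions.

Set Implicit Arguments.
Unset Strict Implicit.
Unset Printing Implicit Defensive.

Local Open Scope classical_set_scope.
Local Open Scope group_scope.

(** The group B4 / Z is a group of automorphisms of the free group F2 on a, b.
    Letting sigma1, sigma2, sigma3 act by
      b |-> a b,   a |-> b^-1 a,   b |-> b a
    (the other basis element being fixed) respects the braid relations, and
    then tau acts as the quarter turn a |-> b^-1, b |-> a, of order four, while
    tau^2 Delta acts as conjugation by a, hence its conjugate by tau as
    conjugation by b.  So all inner automorphisms of F2 come from braids.  A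
    central braid commutes with them, and since F2 has trivial centre it acts
    trivially: the action factors through B4 / Z ([quotient_action_exists]).

    Let P = <t, d | t^4 = d^2 = 1>.  As tau^4 and Delta^2 are central in B4
    ([tau4_center], [Delta2_center]), there is a homomorphism f from P to
    B4 / Z sending t, d to the classes of tau, Delta; its image is G / Z.

    For injectivity, send F2 to P by a |-> t^2 d and b |-> t^-1 (t^2 d) t.
    Conjugation by t permutes these two elements and their inverses exactly as
    the quarter turn permutes a, b and theirs, so the image of F2 is normalised
    by t and every element of P has the form [P_free w * P_tau ^+ k] with k < 4
    ([P_factor]).  Through f, such an element acts on F2 as conjugation by w
    composed with the k-th power of the quarter turn.  If that is the identity,
    then comparing exponent sums of a shows k = 0, and w is central in F2, so
    w = 1 ([inner_tau_eq1]). *)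

(** * Subgroups, quotients and presentations *)

Local Notation "{ 'hom' H -> K }" := (UMagmaMorphism.type H%type K%type)
  (H at level 98, K at level 99, format "{ 'hom'  H  ->  K }") : type_scope.

(** In groups, preserving products suffices: f 1 is idempotent, hence trivial.
    This upgrades product-preserving maps to monoid morphisms. *)
Lemma group_morph1 (H K : groupType) (f : H -> K) :
  {morph f : x y / x * y} -> monoid_morphism f.
Proof.
move=> fM; split=> //; apply: (mulgI (f 1)).
by rewrite -fM !mulg1.
Qed.

Lemma preimage_subgroup (H K : groupType) (f : {hom H -> K})
    (S : set K) :
  is_subgroup S -> is_subgroup (f @^-1` S).
Proof.
move=> [S1 SF]; split=> [|x y Sx Sy] /=; first by rewrite gmulf1.
by rewrite gmulfF; apply: SF.
Qed.

Lemma image_subgroup (H K : groupType) (f : {hom H -> K})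
    (S : set H) :
  is_subgroup S -> is_subgroup (f @` S).
Proof.
move=> [S1 SF]; split=> [|_ _ [x Sx <-] [y Sy <-]].
  by exists 1; rewrite ?gmulf1.
by exists (x / y); [apply: SF | rewrite gmulfF].
Qed.

Lemma generated_subgroupP (H : groupType) (A : set H) :
  is_subgroup (generated_subgroup A).
Proof.
split=> [S [[S1 _] _] //|x y Ax Ay S SA].
by apply: SA.1.2; [apply: Ax | apply: Ay].
Qed.

Lemma commutant_subgroup (H : groupType) (z : H) :
  is_subgroup [set x | commute z x].
Proof.
split=> [|x y zx zy] /=; first exact: commute1.
by apply: commuteM => //; apply: commuteV.
Qed.

HB.instance Definition _ (H : groupType) (N : normal_subgroup H) :=
  isUMagmaMorphism.Build H (quotient_group N) (coset N)
    (group_morph1 (@coset_morphism H N)).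

Lemma coset_eq1 (H : groupType) (N : normal_subgroup H) (x : H) :
  coset N x = 1 <-> normal_set N x.
Proof.
split=> [x1|Nx]; last first.
  by apply/esym; rewrite -[1]/(coset N 1); apply/cosetP; rewrite invg1 mul1g.
have /cosetP : coset N 1 = coset N x by rewrite x1.
by rewrite invg1 mul1g.
Qed.

Lemma quotient_lift (H K : groupType) (N : normal_subgroup H)
    (f : {hom H -> K}) :
  (forall x, normal_set N x -> f x = 1) ->
  exists g : {hom quotient_group N -> K},
    forall x, g (coset N x) = f x.
Proof.
move=> fN; pose g (X : quotient_group N) := f (repr X).
have gE x : g (coset N x) = f x.
  have /cosetP /fN : coset N (repr (coset N x)) = coset N x.
    exact: coset_repr.
  by rewrite gmulfM gmulfV => /mulg1_eq; rewrite invgK.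
have gM : {morph g : X Y / X * Y}.
  elim/coset_ind=> x; elim/coset_ind=> y.
  by rewrite -coset_morphism !gE gmulfM.
pose gmul := isUMagmaMorphism.Build _ _ g (group_morph1 gM).
pose gh : {hom quotient_group N -> K} := HB.pack g gmul.
by exists gh.
Qed.

Definition eval_letter (n : nat) (H : groupType) (g : 'I_n -> H)
    (c : 'I_n * bool) : H :=
  if c.2 then (g c.1)^-1 else g c.1.

Definition free_lift (n : nat) (H : groupType) (g : 'I_n -> H)
    (x : free_group n) : H :=
  \prod_(c <- repr x) eval_letter g c.

Section FreeLift.
Context (n : nat) (H : groupType) (g : 'I_n -> H).

Lemma free_lift_word (u : word n) :
  free_lift g (word_class u) = \prod_(c <- u) eval_letter g c.
Proof.
rewrite /free_lift; set v := repr _.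
have /word_classP : word_class v = word_class u by exact: word_class_repr.
elim=> {u v} [//|u v _ ->//|u v w _ -> _ ->//|u v i b].
rewrite !big_cat /= !big_cons /eval_letter /=; congr (_ * _).
by case: b; rewrite /= ?mulKg ?mulVKg.
Qed.

Lemma free_liftM : {morph free_lift g : x y / x * y}.
Proof.
elim/word_class_ind=> u; elim/word_class_ind=> v.
by rewrite [_ * _]word_classM !free_lift_word big_cat.
Qed.

HB.instance Definition _ :=
  isUMagmaMorphism.Build (free_group n) H (free_lift g)
    (group_morph1 free_liftM).

Lemma free_lift_gen (i : 'I_n) : free_lift g (free_gen i) = g i.
Proof. by rewrite free_lift_word big_seq1. Qed.

End FreeLift.

Lemma free_gen_ind (n : nat) (S : set (free_group n)) :
  is_subgroup S -> (forall i, S (free_gen i)) -> forall x, S x.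
Proof.
move=> [S1 SF] Sgen; have SV x : S x -> S x^-1.
  by move=> /(SF _ _ S1); rewrite mul1g.
have SM x y : S x -> S y -> S (x * y).
  by move=> Sx /SV /(SF _ _ Sx); rewrite invgK.
elim/word_class_ind; elim=> [//|[i b] u IH].
rewrite -[word_class _]/(word_class ([:: (i, b)] ++ u)) -word_classM.
apply: SM IH; case: b; last exact: Sgen.
have -> : word_class [:: (i, true)] = (free_gen i)^-1.
  by rewrite [RHS]word_classV.
exact: SV.
Qed.

Lemma free_hom_ext (n : nat) (H : groupType)
    (f g : {hom free_group n -> H}) :
  (forall i, f (free_gen i) = g (free_gen i)) -> f =1 g.
Proof.
move=> fg; apply: free_gen_ind fg; split=> [|x y fgx fgy] /=.
  by rewrite !gmulf1.
by rewrite !gmulfF fgx fgy.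
Qed.

Lemma presented_gen_ind (n : nat) (R : set (free_group n))
    (S : set (presented_group R)) :
  is_subgroup S -> (forall i, S (presented_gen R i)) -> forall x, S x.
Proof.
move=> Ssub Sgen; elim/coset_ind.
exact: (free_gen_ind (preimage_subgroup (coset _) Ssub) Sgen).
Qed.

Lemma presented_relator (n : nat) (R : set (free_group n)) (r : free_group n) :
  R r -> coset (normal_closure_group R) r = 1.
Proof. by move=> Rr; apply/coset_eq1 => N [_]; apply. Qed.

(** Von Dyck's theorem: the kernel of the lift to the free group is a normal
    subgroup containing the relators, hence contains their normal closure. *)
Lemma presented_lift (n : nat) (R : set (free_group n)) (H : groupType)
    (g : 'I_n -> H) :
  (forall r, R r -> free_lift g r = 1) ->
  exists f : {hom presented_group R -> H},
    forall i, f (presented_gen R i) = g i.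
Proof.
move=> gR; have [|f fE] :=
    @quotient_lift _ _ (normal_closure_group R) (free_lift g).
  move=> x /(_ [set x | free_lift g x = 1]); apply; split=> //.
  split=> [|y z /= y1]; last by rewrite gmulfJ /= y1 conj1g.
  split=> [|y z /= y1 z1]; first exact: gmulf1.
  by rewrite gmulfF /= y1 z1 divgg.
by exists f => i; rewrite fE /= free_lift_gen.
Qed.

(** * Reduced words and the centre of a free group *)

(** Van der Waerden's argument: the letters act on the set of reduced words by
    multiplication followed by cancellation, inverse letters acting as inverse
    maps.  Hence freely equal words act in the same way, and a reduced word is
    recovered as its action on the empty word. *)
Section ReducedWords.
Context {n : nat}.
Implicit Types (c d : 'I_n * bool) (u v w : word n).

Definition reduced w := sorted (fun c d => d != inv_letter c) w.

Definition push c w : word n :=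
  if w is d :: w' then if d == inv_letter c then w' else c :: w else [:: c].

Lemma push_reduced c w : reduced w -> reduced (push c w).
Proof.
case: w => [//|d w] /= dw; case: eqP => [_|/eqP cd].
  exact: path_sorted dw.
by rewrite /= cd.
Qed.

Lemma push_cons c w : reduced (c :: w) -> push c w = c :: w.
Proof. by case: w => [//|d w] /= /andP[/negPf ->]. Qed.

Lemma pushK c w : reduced w -> push c (push (inv_letter c) w) = w.
Proof.
case: w => [|d w] rw /=; first by rewrite eqxx.
rewrite inv_letterK; case: eqP rw => [-> rw|_ _ /=]; last by rewrite eqxx.
exact: push_cons.
Qed.

Lemma foldr_push_reduced u w : reduced w -> reduced (foldr push w u).
Proof. by move=> rw; elim: u => [//|c u IH] /=; apply: push_reduced. Qed.

Lemma free_eq_foldr_push u v w :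
  free_eq u v -> reduced w -> foldr push w u = foldr push w v.
Proof.
move=> uv; elim: uv w => {u v}
  [//|u v _ IH w /IH//|v u w _ uv _ vw x rx|u v i b w rw].
  by rewrite uv ?vw.
rewrite !foldr_cat /= -[(i, ~~ b)]/(inv_letter (i, b)) pushK //.
exact: foldr_push_reduced.
Qed.

Definition normal_form u : word n := foldr push [::] u.

Lemma normal_form_reduced u : reduced (normal_form u).
Proof. exact: foldr_push_reduced. Qed.

Lemma reduced_normal_form w : reduced w -> normal_form w = w.
Proof.
elim: w => [//|c w IH] rw; rewrite /normal_form /= -/(normal_form w).
by rewrite IH ?push_cons //; apply: path_sorted rw.
Qed.

Lemma push_free_eq c w : free_eq (c :: w) (push c w).
Proof.
case: w => [|d w] /=; first exact: free_eq_refl.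
case: eqP => [->|_]; last exact: free_eq_refl.
by case: c => i b; apply: (free_eq_cancel [::] w i b).
Qed.

Lemma normal_form_free_eq u : free_eq u (normal_form u).
Proof.
elim: u => [|c u IH]; first exact: free_eq_refl.
apply: free_eq_trans (push_free_eq _ _).
by apply: (free_eq_cat (free_eq_refl [:: c])).
Qed.

Lemma reduced_word_class_inj u v :
  reduced u -> reduced v -> word_class u = word_class v -> u = v.
Proof.
move=> /reduced_normal_form {2}<- /reduced_normal_form {2}<- /word_classP uv.
exact: free_eq_foldr_push.
Qed.

Lemma reduced_rcons c w :
  reduced (rcons w c) =
  reduced w && ((w == [::]) || (c != inv_letter (last c w))).
Proof. by case: w => [//|d w]; rewrite /reduced /= rcons_path. Qed.

End ReducedWords.

(** If x is a nonempty reduced word d w, choose a letter c whose generator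
    differs from that of d and which does not cancel after the last letter of
    x.  Then c x and x c are both reduced; they start with different letters,
    so x does not commute with c. *)
Lemma free_group_center (n : nat) (x : free_group n) :
  1 < n -> center (free_group n) x -> x = 1.
Proof.
move=> n1; elim/word_class_ind: x => u.
have /word_classP -> := normal_form_free_eq u.
have := normal_form_reduced u; case: (normal_form u) => {u} [//|d w] rw Zw.
have [j jd] : exists j, j != d.1.
  case: (eqVneq d.1 (Ordinal n1)) => [->|]; last first.
    by rewrite eq_sym; exists (Ordinal n1).
  by exists (Ordinal (ltnW n1)).
(* Giving c the sign of the last letter rules out that they are inverse. *)
pose c := (j, (last d w).2).
have rcw : reduced (c :: d :: w).
  by apply/andP; split=> //=; apply: contra jd => /eqP ->.
have rwc : reduced (rcons (d :: w) c).
  rewrite reduced_rcons rw /=; apply/eqP => /(congr1 snd) /=.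
  by case: (last d w).2.
have := Zw (word_class [:: c]).
rewrite /commute [X in X = _]word_classM [X in _ = X]word_classM /= cats1.
move=> /(reduced_word_class_inj rwc rcw) [dc _].
by rewrite dc eqxx in jd.
Qed.

(** * Automorphism groups *)

(** The inverse map is stored so that the inverse automorphism is given by
    swapping fields; it is determined by the map itself, see [aut_ext]. *)
Record automorphism (T : groupType) := Automorphism {
  aut_fun :> T -> T;
  aut_inv : T -> T;
  aut_funK : cancel aut_fun aut_inv;
  aut_invK : cancel aut_inv aut_fun;
  aut_funM : {morph aut_fun : x y / x * y} }.

HB.instance Definition _ (T : groupType) (f : automorphism T) :=
  isUMagmaMorphism.Build T T f (group_morph1 (@aut_funM T f)).

Lemma aut_ext (T : groupType) (f g : automorphism T) : f =1 g -> f = g.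
Proof.
case: f g => [f f' fK f'K fM] [g g' gK g'K gM] /= /funext fg.
have f'g' : f' = g' by apply/funext => x; rewrite -[x in LHS]g'K -fg fK.
by subst g g'; congr Automorphism; apply: Prop_irrelevance.
Qed.

Section AutomorphismGroup.
Context (T : groupType).
Implicit Types f g h : automorphism T.

HB.instance Definition _ := gen_eqMixin (automorphism T).
HB.instance Definition _ := gen_choiceMixin (automorphism T).

Lemma aut_invM f : {morph aut_inv f : x y / x * y}.
Proof.
by move=> x y; apply: (can_inj (aut_funK f)); rewrite aut_funM !aut_invK.
Qed.

Definition aut_one : automorphism T :=
  @Automorphism T id id (fun=> erefl) (fun=> erefl) (fun _ _ => erefl).

Lemma aut_compM f g : {morph f \o g : x y / x * y}.
Proof. by move=> x y /=; rewrite !aut_funM. Qed.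

Definition aut_comp f g : automorphism T :=
  @Automorphism T (f \o g) (aut_inv g \o aut_inv f)
    (can_comp (aut_funK f) (aut_funK g))
    (can_comp (aut_invK g) (aut_invK f)) (@aut_compM f g).

Definition aut_opp f : automorphism T :=
  Automorphism (aut_invK f) (aut_funK f) (@aut_invM f).

Lemma aut_compA : associative aut_comp.
Proof. by move=> f g h; apply: aut_ext. Qed.

Lemma aut_comp1g : left_id aut_one aut_comp.
Proof. by move=> f; apply: aut_ext. Qed.

Lemma aut_compg1 : right_id aut_one aut_comp.
Proof. by move=> f; apply: aut_ext. Qed.

Lemma aut_compVg : left_inverse aut_one aut_opp aut_comp.
Proof. by move=> f; apply: aut_ext => x /=; rewrite aut_funK. Qed.

Lemma aut_compgV : right_inverse aut_one aut_opp aut_comp.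
Proof. by move=> f; apply: aut_ext => x /=; rewrite aut_invK. Qed.

HB.instance Definition _ := isGroup.Build (automorphism T)
  aut_compA aut_comp1g aut_compg1 aut_compVg aut_compgV.

Lemma aut_mulE f g x : (f * g) x = f (g x).
Proof. by []. Qed.

Lemma aut_oneE x : (1 : automorphism T) x = x.
Proof. by []. Qed.

Lemma autXS f k x : (f ^+ k.+1) x = f ((f ^+ k) x).
Proof. by rewrite expgS. Qed.

Lemma inner_funM (w : T) : {morph (fun x => x ^ w^-1) : x y / x * y}.
Proof. by move=> x y; rewrite conjMg. Qed.

Definition inner (w : T) : automorphism T :=
  @Automorphism T (fun x => x ^ w^-1) (fun x => x ^ w)
    (conjgKV w) (conjgK w) (@inner_funM w).

Lemma innerE w x : inner w x = w * x * w^-1.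
Proof. by rewrite /= conjgE invgK mulgA. Qed.

Lemma innerM : {morph inner : v w / v * w}.
Proof. by move=> v w; apply: aut_ext => x /=; rewrite invgM conjgM. Qed.

HB.instance Definition _ :=
  isUMagmaMorphism.Build T (automorphism T) inner (group_morph1 innerM).

(** Conjugating the inner automorphism of w by f gives that of f w; this is how
    commuting with inner automorphisms constrains f. *)
Lemma aut_inner f w : f * inner w = inner (f w) * f.
Proof.
apply: aut_ext => x; rewrite !aut_mulE /= -[f _]/((f : {hom T -> T}) _).
by rewrite gmulfJ gmulfV.
Qed.

Lemma inner_eq1 w : inner w = 1 -> center T w.
Proof.
move=> w1 x; have /= : inner w x = x by rewrite w1.
by rewrite conjgE invgK mulgA => /(congr1 (fun y => y * w)); rewrite mulgVK.
Qed.

End AutomorphismGroup.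

(** * Central elements of the braid group *)

(** The rules below carry a trailing factor x, so that with products associated
    to the right they rewrite at any place of a word.  They say that tau moves
    s1 to s2 to s3 under conjugation, that tau^2 moves s3 back to s1, and that
    Delta exchanges s1 and s3 and fixes s2; so tau^4 and Delta^2 commute with
    every generator. *)
Section BraidRelations.
Context (H : groupType) (s1 s2 s3 : H).
Hypothesis braid12 : s1 * s2 * s1 = s2 * s1 * s2.
Hypothesis braid23 : s2 * s3 * s2 = s3 * s2 * s3.
Hypothesis comm13 : s1 * s3 = s3 * s1.

Let t := s1 * s2 * s3.
Let d := s1 * s2 * s3 * s1 * s2 * s1.

Let r12 x : s1 * (s2 * (s1 * x)) = s2 * (s1 * (s2 * x)).
Proof. by rewrite !mulgA braid12. Qed.

Let r23 x : s2 * (s3 * (s2 * x)) = s3 * (s2 * (s3 * x)).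
Proof. by rewrite !mulgA braid23. Qed.

Let r13 x : s1 * (s3 * x) = s3 * (s1 * x).
Proof. by rewrite !mulgA comm13. Qed.

Let tE x : t * x = s1 * (s2 * (s3 * x)).
Proof. by rewrite !mulgA. Qed.

Let dE x : d * x = t * (s1 * (s2 * (s1 * x))).
Proof. by rewrite !mulgA. Qed.

Let t1 x : t * (s1 * x) = s2 * (t * x).
Proof. by rewrite !tE -r13 r12. Qed.

Let t2 x : t * (s2 * x) = s3 * (t * x).
Proof. by rewrite !tE r23 r13. Qed.

Let t3 x : t * (t * (s3 * x)) = s1 * (t * (t * x)).
Proof.
(* Both sides become s1 s1 s2 s1 s2 s3 s2 x. *)
by rewrite !tE -[in LHS]r13 -[in LHS]r23 -[in LHS]r23 -[in LHS]r12 -r13 -r23.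
Qed.

Let d1 x : d * (s1 * x) = s3 * (d * x).
Proof. by rewrite !dE -t2 -r12. Qed.

Let d2 x : d * (s2 * x) = s2 * (d * x).
Proof. by rewrite !dE -t1 -[in LHS]r12. Qed.

Let d3 x : d * (s3 * x) = s1 * (d * x).
Proof.
rewrite !dE r13 -tE !tE.
by rewrite -[in LHS]r13 -[in LHS]r23 -[in LHS]r12 [in LHS]r13.
Qed.

Lemma braid_tau4_commute :
  [/\ commute (t ^+ 4) s1, commute (t ^+ 4) s2 & commute (t ^+ 4) s3].
Proof.
suff tC x : [/\ t ^+ 4 * (s1 * x) = s1 * (t ^+ 4 * x),
    t ^+ 4 * (s2 * x) = s2 * (t ^+ 4 * x) &
    t ^+ 4 * (s3 * x) = s3 * (t ^+ 4 * x)].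
  by have := tC 1; rewrite !mulg1.
have t4E y : t ^+ 4 * y = t * (t * (t * (t * y))).
  by rewrite !expgS expg0 mulg1 !mulgA.
by rewrite !t4E; split; rewrite ?(t1, t2, t3).
Qed.

Lemma braid_Delta2_commute :
  [/\ commute (d ^+ 2) s1, commute (d ^+ 2) s2 & commute (d ^+ 2) s3].
Proof.
suff dC x : [/\ d ^+ 2 * (s1 * x) = s1 * (d ^+ 2 * x),
    d ^+ 2 * (s2 * x) = s2 * (d ^+ 2 * x) &
    d ^+ 2 * (s3 * x) = s3 * (d ^+ 2 * x)].
  by have := dC 1; rewrite !mulg1.
have d2E y : d ^+ 2 * y = d * (d * y) by rewrite expg2 !mulgA.
by rewrite !d2E; split; rewrite ?(d1, d2, d3).
Qed.

End BraidRelations.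

Lemma sigma_braid12 : sigma1 * sigma2 * sigma1 = sigma2 * sigma1 * sigma2.
Proof.
have := @presented_relator _ braid4_relators _ (or_introl (or_introl erefl)).
by rewrite gmulfF !gmulfM => /divg1_eq.
Qed.

Lemma sigma_braid23 : sigma2 * sigma3 * sigma2 = sigma3 * sigma2 * sigma3.
Proof.
have := @presented_relator _ braid4_relators _ (or_introl (or_intror erefl)).
by rewrite gmulfF !gmulfM => /divg1_eq.
Qed.

Lemma sigma_comm13 : sigma1 * sigma3 = sigma3 * sigma1.
Proof.
have := @presented_relator _ braid4_relators _ (or_intror erefl).
by rewrite gmulfF !gmulfM => /divg1_eq.
Qed.

Lemma ord2E (i : 'I_2) : i = inord 0 \/ i = inord 1.
Proof.
by case: i => [[|[|//]] ?]; [left | right]; apply: val_inj; rewrite /= inordK.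
Qed.

Lemma ord3E (i : 'I_3) : [\/ i = inord 0, i = inord 1 | i = inord 2].
Proof.
by case: i => [[|[|[|//]]] ?]; [constructor 1 | constructor 2 | constructor 3];
  apply: val_inj; rewrite /= inordK.
Qed.

Lemma B4_center (z : B4) :
  [/\ commute z sigma1, commute z sigma2 & commute z sigma3] -> center B4 z.
Proof.
move=> [z1 z2 z3]; apply: (presented_gen_ind (commutant_subgroup z)) => i.
by have [->|->|->] := ord3E i.
Qed.

Lemma tau4_center : center B4 (tau ^+ 4).
Proof.
exact/B4_center/(braid_tau4_commute sigma_braid12 sigma_braid23 sigma_comm13).
Qed.

Lemma Delta2_center : center B4 (Delta ^+ 2).
Proof.
exact/B4_center/(braid_Delta2_commute sigma_braid12 sigma_braid23 sigma_comm13).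
Qed.

(** * The action of the braid group on a free group of rank two *)

Local Notation F2 := (free_group 2).

Definition a : F2 := free_gen (inord 0).
Definition b : F2 := free_gen (inord 1).

Definition F2_lift (H : groupType) (x y : H) : {hom F2 -> H} :=
  free_lift (fun i : 'I_2 => nth 1 [:: x; y] i).

Lemma F2_lift_a (H : groupType) (x y : H) : F2_lift x y a = x.
Proof. by rewrite /= free_lift_gen inordK. Qed.

Lemma F2_lift_b (H : groupType) (x y : H) : F2_lift x y b = y.
Proof. by rewrite /= free_lift_gen inordK. Qed.

Lemma F2_hom_ext (H : groupType) (f g : {hom F2 -> H}) :
  f a = g a -> f b = g b -> f =1 g.
Proof.
by move=> fga fgb; apply: free_hom_ext => i; have [->|->] := ord2E i.
Qed.

Lemma F2_liftK (x y x' y' : F2) :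
  F2_lift x' y' x = a -> F2_lift x' y' y = b ->
  cancel (F2_lift x y) (F2_lift x' y').
Proof.
move=> xa yb.
apply: (@F2_hom_ext _ (F2_lift x' y' \o F2_lift x y) idfun) => /=.
  by rewrite F2_lift_a.
by rewrite F2_lift_b.
Qed.

Definition F2_aut (x y x' y' : F2) (K : cancel (F2_lift x y) (F2_lift x' y'))
    (K' : cancel (F2_lift x' y') (F2_lift x y)) : automorphism F2 :=
  Automorphism K K' (@gmulfM _ _ (F2_lift x y)).

Local Ltac check_inverse_lift :=
  by apply: F2_liftK; rewrite /= ?(gmulfM, gmulfV) /= ?(F2_lift_a, F2_lift_b)
    ?(mulKg, mulVKg, mulgK, mulgVK).

Fact rho1_funK : cancel (F2_lift a (a * b)) (F2_lift a (a^-1 * b)).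
Proof. check_inverse_lift. Qed.
Fact rho1_invK : cancel (F2_lift a (a^-1 * b)) (F2_lift a (a * b)).
Proof. check_inverse_lift. Qed.
Definition rho1 : automorphism F2 := F2_aut rho1_funK rho1_invK.

Fact rho2_funK : cancel (F2_lift (b^-1 * a) b) (F2_lift (b * a) b).
Proof. check_inverse_lift. Qed.
Fact rho2_invK : cancel (F2_lift (b * a) b) (F2_lift (b^-1 * a) b).
Proof. check_inverse_lift. Qed.
Definition rho2 : automorphism F2 := F2_aut rho2_funK rho2_invK.

Fact rho3_funK : cancel (F2_lift a (b * a)) (F2_lift a (b * a^-1)).
Proof. check_inverse_lift. Qed.
Fact rho3_invK : cancel (F2_lift a (b * a^-1)) (F2_lift a (b * a)).
Proof. check_inverse_lift. Qed.
Definition rho3 : automorphism F2 := F2_aut rho3_funK rho3_invK.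

Fact rho1_a : rho1 a = a. Proof. exact: F2_lift_a. Qed.
Fact rho1_b : rho1 b = a * b. Proof. exact: F2_lift_b. Qed.
Fact rho2_a : rho2 a = b^-1 * a. Proof. exact: F2_lift_a. Qed.
Fact rho2_b : rho2 b = b. Proof. exact: F2_lift_b. Qed.
Fact rho3_a : rho3 a = a. Proof. exact: F2_lift_a. Qed.
Fact rho3_b : rho3 b = b * a. Proof. exact: F2_lift_b. Qed.
Definition rhoE := (rho1_a, rho1_b, rho2_a, rho2_b, rho3_a, rho3_b).

Lemma autV (T : groupType) (f : automorphism T) : {morph f : x / x^-1}.
Proof. exact: (gmulfV (f : {hom T -> T})). Qed.

Lemma F2_aut_ext (f g : automorphism F2) : f a = g a -> f b = g b -> f = g.
Proof. by move=> fga fgb; apply/aut_ext/(@F2_hom_ext F2 f g). Qed.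

Definition rho_tau := rho1 * rho2 * rho3.
Definition rho_Delta := rho1 * rho2 * rho3 * rho1 * rho2 * rho1.

Local Ltac aut_compute :=
  by rewrite ?aut_mulE ?(rhoE, aut_funM, autV, innerE) ?(mulgA, invgM, invgK)
    ?(mulVg, mulgV, mul1g, mulgK, mulgVK).

Lemma rho_braid12 : rho1 * rho2 * rho1 = rho2 * rho1 * rho2.
Proof. apply: F2_aut_ext; aut_compute. Qed.

Lemma rho_braid23 : rho2 * rho3 * rho2 = rho3 * rho2 * rho3.
Proof. apply: F2_aut_ext; aut_compute. Qed.

Lemma rho_comm13 : rho1 * rho3 = rho3 * rho1.
Proof. apply: F2_aut_ext; aut_compute. Qed.

Lemma rho_tau_a : rho_tau a = b^-1.
Proof. aut_compute. Qed.

Lemma rho_tau_b : rho_tau b = a.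
Proof. aut_compute. Qed.

(** Writing Delta as tau followed on the right by sigma1 sigma2 sigma1 keeps the
    words short: the second factor sends a, b to b^-1, b^-1 a b. *)
Lemma rho_DeltaE : rho_Delta = rho_tau * (rho1 * rho2 * rho1).
Proof. by rewrite /rho_Delta !mulgA. Qed.

Lemma rho_Delta_a : rho_Delta a = a^-1.
Proof.
have -> : rho_Delta a = rho_tau b^-1; last by rewrite autV rho_tau_b.
rewrite rho_DeltaE [LHS]aut_mulE; congr (rho_tau _); aut_compute.
Qed.

Lemma rho_Delta_b : rho_Delta b = a^-1 * b^-1 * a.
Proof.
have -> : rho_Delta b = rho_tau (b^-1 * a * b).
  rewrite rho_DeltaE [LHS]aut_mulE; congr (rho_tau _); aut_compute.
by rewrite !aut_funM autV rho_tau_a rho_tau_b.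
Qed.

Lemma rho_tau2_Delta : rho_tau ^+ 2 * rho_Delta = inner a.
Proof.
have E x : (rho_tau ^+ 2 * rho_Delta) x = rho_tau (rho_tau (rho_Delta x)).
  by [].
apply: F2_aut_ext; rewrite innerE E.
  rewrite rho_Delta_a !(autV, rho_tau_a, rho_tau_b).
  by rewrite !invgK mulgK.
rewrite rho_Delta_b !(aut_funM, autV, rho_tau_a, rho_tau_b).
by rewrite !invgK.
Qed.

Lemma rho_tau2_Delta_conj : (rho_tau ^+ 2 * rho_Delta) ^ rho_tau = inner b.
Proof.
by rewrite rho_tau2_Delta conjgE -rho_tau_b -aut_inner mulKg.
Qed.

Lemma braid_action_exists : exists rho : {hom B4 -> automorphism F2},
  rho tau = rho_tau /\ rho Delta = rho_Delta.
Proof.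
pose g (i : 'I_3) := nth 1 [:: rho1; rho2; rho3] i.
have [|f fE] := @presented_lift _ braid4_relators _ g.
  move=> r [[->|->]|->];
    rewrite gmulfF !gmulfM /= !free_lift_gen /g !inordK //=.
  - by rewrite rho_braid12 divgg.
  - by rewrite rho_braid23 divgg.
  - by rewrite rho_comm13 divgg.
have f1 : f sigma1 = rho1 by rewrite fE /g inordK.
have f2 : f sigma2 = rho2 by rewrite fE /g inordK.
have f3 : f sigma3 = rho3 by rewrite fE /g inordK.
by exists f; rewrite !gmulfM f1 f2 f3.
Qed.

(** A braid acting as conjugation by w commutes with a central braid z, whose
    action must then fix w up to the centre of F2, which is trivial.  Both a
    and b occur as such w, so z acts trivially. *)
Lemma quotient_action_exists :
  exists rho : {hom quotient_group Z -> automorphism F2},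
    rho (coset Z tau) = rho_tau /\ rho (coset Z Delta) = rho_Delta.
Proof.
have [rho [rhot rhoD]] := braid_action_exists.
have rho_center z : center B4 z -> rho z = 1.
  move=> Zz.
  have fixed w x : rho x = inner w -> rho z w = w.
    move=> xw; have := congr1 rho (Zz x); rewrite !gmulfM xw aut_inner.
    move=> /mulIg /(congr1 (fun f => f / inner w)).
    rewrite mulgV -gmulfF => /inner_eq1 /free_group_center.
    by move=> /(_ isT) /divg1_eq.
  have rhoX : rho (tau ^+ 2 * Delta) = inner a.
    by rewrite gmulfM gmulfXn rhot rhoD rho_tau2_Delta.
  have rhoY : rho ((tau ^+ 2 * Delta) ^ tau) = inner b.
    rewrite -rho_tau2_Delta_conj rho_tau2_Delta -rhoX -rhot.
    exact: (gmulfJ rho).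
  by apply: F2_aut_ext; [exact: fixed rhoX | exact: fixed rhoY].
have [f fE] := quotient_lift (N := Z) rho_center.
by exists f; rewrite !fE.
Qed.

(** * The group with presentation t^4 = d^2 = 1 *)

Local Notation P := (presented_group tau_Delta_relators).
Definition P_tau : P := presented_gen tau_Delta_relators (inord 0).
Definition P_Delta : P := presented_gen tau_Delta_relators (inord 1).

Lemma P_tau4 : P_tau ^+ 4 = 1.
Proof.
have := @presented_relator _ tau_Delta_relators _ (or_introl erefl).
by rewrite gmulfXn.
Qed.

Lemma P_Delta2 : P_Delta ^+ 2 = 1.
Proof.
have := @presented_relator _ tau_Delta_relators _ (or_intror erefl).
by rewrite gmulfXn.
Qed.

(** The element that will act on F2 as conjugation by a. *)
Definition P_a : P := P_tau ^+ 2 * P_Delta.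
Definition P_free : {hom F2 -> P} := F2_lift P_a (P_a ^ P_tau).

(** As u = P_tau ^+ 2 and d = P_Delta square to 1, the element u d and its
    conjugate d u by u are inverse to each other; this mirrors the fact that
    the square of the quarter turn inverts a. *)
Lemma P_a_conj_tau2 : (P_a ^ P_tau) ^ P_tau = P_a^-1.
Proof.
have key (u d : P) : u * u = 1 -> d * d = 1 -> (u * d) * (u * d) ^ u = 1.
  by move=> uu dd; rewrite conjgE -!mulgA mulKg (mulgA d) dd mul1g.
apply/esym/mulg1_eq; rewrite -conjgM -expg2; apply: key.
  by rewrite -expgnDr; apply: P_tau4.
by rewrite -expg2; apply: P_Delta2.
Qed.

(** The homomorphism is equivariant: conjugation by tau in P restricts, on the
    image of F2, to the quarter turn. *)
Lemma P_free_tau w : P_free (rho_tau w) = P_free w ^ P_tau^-1.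
Proof.
pose f : {hom F2 -> P} := P_free \o rho_tau.
pose g : {hom F2 -> P} := inner P_tau \o P_free.
have Pa : P_free a = P_a by exact: F2_lift_a.
have Pb : P_free b = P_a ^ P_tau by exact: F2_lift_b.
apply: (@F2_hom_ext _ f g) w.
  rewrite -[f a]/(P_free (rho_tau a)) -[g a]/(P_free a ^ P_tau^-1).
  rewrite rho_tau_a gmulfV Pa Pb; apply: (conjg_inj P_tau).
  by rewrite conjgKV conjVg P_a_conj_tau2 invgK.
rewrite -[f b]/(P_free (rho_tau b)) -[g b]/(P_free b ^ P_tau^-1).
by rewrite rho_tau_b Pa Pb conjgK.
Qed.

Lemma P_free_tauX w k :
  P_free ((rho_tau ^+ k) w) = P_tau ^+ k * P_free w * (P_tau ^+ k)^-1.
Proof.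
elim: k => [|k IH]; first by rewrite !expg0 mul1g invg1 mulg1.
by rewrite !expgS aut_mulE P_free_tau IH conjgE invgK invgM !mulgA.
Qed.

Lemma expg_mod4 (H : groupType) (x : H) k :
  x ^+ 4 = 1 -> x ^+ (k %% 4) = x ^+ k.
Proof.
move=> x4.
by rewrite [in RHS](divn_eq k 4) expgnDr mulnC expgnA x4 expg1n mul1g.
Qed.

(** The image of F2 is normalised by P_tau, so its product with the cyclic group
    of P_tau is a subgroup; it contains both generators of P. *)
Lemma P_factor (p : P) : exists w k, k < 4 /\ p = P_free w * P_tau ^+ k.
Proof.
suff : [set p | exists w k, p = P_free w * P_tau ^+ k] p.
  move=> [w [k ->]]; exists w, (k %% 4).
  by rewrite ltn_mod (expg_mod4 _ P_tau4).
apply: presented_gen_ind p => [|i]; last first.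
  have [->|->] := ord2E i; first by exists 1, 1%N; rewrite gmulf1 mul1g.
  (* P_Delta = P_tau^2 P_a, as P_tau^4 = 1; then move P_tau^2 to the right. *)
  exists ((rho_tau ^+ 2) a), 2%N.
  rewrite P_free_tauX mulgVK [P_free a]F2_lift_a /P_a mulgA -expgnDr.
  by rewrite P_tau4 mul1g.
split=> [|_ _ [v [k ->]] [w [l ->]]].
  by exists 1, 0%N; rewrite gmulf1 mul1g.
exists (v * (rho_tau ^+ (k + 3 * l)%N) w^-1), (k + 3 * l)%N.
have tV : (P_tau ^+ l)^-1 = P_tau ^+ (3 * l).
  by apply: mulg1_eq; rewrite -expgnDr -mulSn expgnA P_tau4 expg1n.
rewrite gmulfM P_free_tauX gmulfV -!mulgA mulVg mulg1.
by rewrite invgM tV (expgnDr _ k) -!mulgA.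
Qed.

(** * The isomorphism *)

(** The exponent sum of a is invariant under conjugation, and it is 1, 0, -1, 0
    on the images a, b^-1, a^-1, b of a under the powers of the quarter turn.
    Modulo 3 these still distinguish k = 0. *)
Lemma inner_tau_eq1 w k :
  k < 4 -> inner w * rho_tau ^+ k = 1 -> w = 1 /\ k = 0.
Proof.
move=> k4 wk.
have k0 : k = 0.
  (* Z/3 is written multiplicatively: its neutral element is 1. *)
  pose e : {hom F2 -> 'Z_3} := F2_lift Zp1 (1 : 'Z_3).
  have eJ x y : e (x ^ y) = e x.
    by rewrite gmulfJ conjgE [_ * e y]Zp_mulgC mulKg.
  have ea : e ((rho_tau ^+ k) a) = e a.
    by rewrite -[LHS](eJ _ w^-1) -[_ ^ _]/((inner w * rho_tau ^+ k) a) wk.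
  have eaE : e a = Zp1 by exact: F2_lift_a.
  have ebE : e b = 1 by exact: F2_lift_b.
  case: k k4 {wk} ea => [|[|[|[|//]]]] // _;
    rewrite ?autXS expg0 aut_oneE.
  - by rewrite rho_tau_a gmulfV eaE ebE => /eqP.
  - by rewrite rho_tau_a autV rho_tau_b gmulfV eaE => /eqP.
  - by rewrite rho_tau_a !autV rho_tau_b rho_tau_a !gmulfV ebE eaE => /eqP.
subst k; rewrite expg0 mulg1 in wk.
by split=> //; apply: free_group_center (inner_eq1 wk).
Qed.

Theorem corollary2p5 :
  exists f : {multiplicative presented_group tau_Delta_relators
                -> quotient_group Z},
    [/\ set_bij [set: presented_group tau_Delta_relators] G_mod_Z f,
        f (presented_gen tau_Delta_relators (inord 0)) = coset Z tau &
        f (presented_gen tau_Delta_relators (inord 1)) = coset Z Delta].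
Proof.
pose g (i : 'I_2) := nth 1 [:: coset Z tau; coset Z Delta] i.
have [|f fE] := @presented_lift _ tau_Delta_relators _ g.
  move=> r [->|->]; rewrite gmulfXn /= free_lift_gen /g inordK //= -gmulfXn.
    exact/coset_eq1/tau4_center.
  exact/coset_eq1/Delta2_center.
have ft : f P_tau = coset Z tau by rewrite fE /g inordK.
have fd : f P_Delta = coset Z Delta by rewrite fE /g inordK.
exists f; split=> //; split.
- move=> p _; apply: (presented_gen_ind (S := f @^-1` G_mod_Z)) p => [|i].
    apply: (@preimage_subgroup _ _ f); apply: (@image_subgroup _ _ (coset Z)).
    exact: generated_subgroupP.
  have [->|->] := ord2E i.
    by exists tau; [move=> S [_]; apply; left | rewrite ft].
  by exists Delta; [move=> S [_]; apply; right | rewrite fd].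
- move=> p q _ _; apply: gmulf_inj => {q} {}p fp.
  have [rho [rhot rhod]] := quotient_action_exists.
  have rho_free w : rho (f (P_free w)) = inner w.
    pose F : {hom F2 -> automorphism F2} := rho \o f \o P_free.
    pose I : {hom F2 -> automorphism F2} := @inner F2.
    have FX : rho (f P_a) = inner a.
      rewrite /P_a [f _]gmulfM [rho _]gmulfM !gmulfXn ft fd rhot rhod.
      exact: rho_tau2_Delta.
    apply: (@F2_hom_ext _ F I).
      rewrite -[F a]/(rho (f (P_free a))).
      by rewrite [P_free a]F2_lift_a FX.
    rewrite -[F b]/(rho (f (P_free b))) [P_free b]F2_lift_b.
    rewrite (gmulfJ f) (gmulfJ rho) FX ft rhot -rho_tau2_Delta.
    exact: rho_tau2_Delta_conj.
  have [w [k [k4 pE]]] := P_factor p.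
  have := congr1 rho fp.
  rewrite pE !gmulfM !gmulfXn ft rhot rho_free gmulf1.
  by case/(inner_tau_eq1 k4) => -> ->; rewrite gmulf1 mul1g.
- move=> _ [x Gx <-].
  suff : (coset Z @^-1` (f @` setT)) x by [].
  apply: Gx; split.
    apply: (@preimage_subgroup _ _ (coset Z)).
    by apply: (@image_subgroup _ _ f).
  by move=> _ [->|->]; [exists P_tau | exists P_Delta].
Qed.
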